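(* Let $\lambda,\mu>0$, $\varrho=\lambda/\mu$ and $N\in\mathbb N$. The stationary probabilities $\rho(k)=\lim_{t\to+\infty}\mathbb P(\mathcal N(t)=k)$ of the number of particles in the multi-type Ehrenfest system are $$\rho(k)=\frac{g(\varrho,N)}{\binom{2N}{N}}\,\varrho^k\binom{2N}{N+k},\qquad k=0,1,\dots,N,$$ where $g(\varrho,N)=1/{}_2F_1(-N,1;1+N;-\varrho)$.
   Context: Multi-type Ehrenfest model: let $N,d\in\mathbb N$, $D=\{1,\dots,d\}$, $\lambda,\mu>0$, and let $C=(c_{l,j})_{l,j\in D}$ be a stochastic matrix ($c_{l,j}\ge 0$, $\sum_{j}c_{l,j}=1$). The system is a continuous-time Markov chain with states $(k,j)$, $k\in\{1,\dots,N\}$, $j\in D$ ($k$ particles, all of type $j$), and the empty states $(0,l)$, $l\in D$ (no particle, the last particles in the system having been of type $l$). The only transitions are: $(k,j)\to(k-1,j)$ at rate $\mu(N+k)$ for $1\le k\le N$; $(k,j)\to(k+1,j)$ at rate $\lambda(N-k)$ for $1\le k\le N-1$; $(0,l)\to(1,j)$ at rate $c_{l,j}\lambda N$. At time $0$ the chain is in $(0,l_0)$ for a fixed $l_0\in D$. $\mathcal N(t)\in\{0,1,\dots,N\}$ denotes the number of particles (first coordinate) at time $t$. ${}_2F_1(a,b;c;z)=\sum_{n\ge0}\frac{(a)_n(b)_n}{(c)_n}\frac{z^n}{n!}$ is the Gauss hypergeometric function (a finite sum when $a$ is a nonpositive integer), $(a)_n=a(a+1)\cdots(a+n-1)$. 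*)

(* Defs.v *)
From HB Require Import structures.
From mathcomp Require Import all_boot all_order all_algebra.
From mathcomp Require Import all_classical all_reals all_analysis.

Set Implicit Arguments.
Unset Strict Implicit.
Unset Printing Implicit Defensive.

Import Order.TTheory GRing.Theory Num.Theory.
Import numFieldNormedType.Exports.

Local Open Scope classical_set_scope.
Local Open Scope ring_scope.

Section Hypergeometric.
Variable R : realType.
Implicit Types a b c z : R.

Definition pochhammer a (n : nat) : R := \prod_(i < n) (a + i%:R).

(* This is junk when the series diverges, or when c is a nonpositive integer
   (division by zero being zero). *)
Definition hyp2F1 a b c z : R :=
  limn (series (fun n : nat =>
    pochhammer a n * pochhammer b n / pochhammer c n * (z ^+ n / n`!%:R))).

End Hypergeometric.

Definition stochastic_mx (R : realType) (d : nat) (C : 'M[R]_d) : Prop :=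
  (forall l j, 0 <= C l j) /\ (forall l, \sum_j C l j = 1).

Section FiniteChain.
Variables (R : realType) (S : finType).

(* Only the values q s s' with s != s' are meaningful as transition rates; the
   diagonal of the generator is determined by them. *)
Definition generator (q : S -> S -> R) (s s' : S) : R :=
  if s == s' then - \sum_(s'' | s'' != s) q s s'' else q s s'.

Record transition_function (q : S -> S -> R) (p : R -> S -> S -> R) : Prop := {
  trans_ge0 : forall (t : R) s s', 0 <= t -> 0 <= p t s s';
  trans_sum1 : forall (t : R) s, 0 <= t -> \sum_s' p t s s' = 1;
  trans_0 : forall s s', p 0 s s' = (s == s')%:R;
  trans_add : forall (t u : R) s s', 0 <= t -> 0 <= u ->
    p (t + u) s s' = \sum_r p t s r * p u r s';
  trans_rate : forall s s',
    (p h s s' - (s == s')%:R) / h @[h --> 0^'+] --> generator q s s'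
}.

(* X t w is the state at time t; only the times t >= 0 matter.
   [markov_prop] is the time-homogeneous Markov property
     P(X_(t+h) = s' | X_t = s, past) = p h s s',
   multiplied by P(X_t = s, past) so that events of probability 0 need no
   special treatment. The past prescribes the states at finitely many times in
   [0, t], given as a list of pairs (time, state). *)
Record markov_chain (d : measure_display) (T : measurableType d)
    (P : probability T R) (X : R -> T -> S) (p : R -> S -> S -> R) : Prop := {
  chain_measurable : forall (t : R) s, 0 <= t -> measurable [set w | X t w = s];
  markov_prop : forall (past : seq (R * S)) (t h : R) (s s' : S),
    {in past, forall us : R * S, 0 <= us.1 <= t} -> 0 <= t -> 0 <= h ->
    let A := [set w | {in past, forall us, X us.1 w = us.2}] in
    (P (A `&` [set w | X t w = s] `&` [set w | X (t + h)%R w = s']) =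
     P (A `&` [set w | X t w = s]) * (p h s s')%:E)%E
}.

Definition ctmc (d : measure_display) (T : measurableType d)
    (P : probability T R) (X : R -> T -> S) (q : S -> S -> R) : Prop :=
  exists2 p, transition_function q p & markov_chain P X p.

End FiniteChain.

Section Ehrenfest.
Variables (R : realType) (N d : nat).

(* (k, j) with 0 < k: k particles of type j;
   (0, l): no particle, the last ones having been of type l.
   Types are numbered from 0. *)
Definition ehrenfest_state : finType := ('I_N.+1 * 'I_d)%type.

Definition ehrenfest_rate (lambda mu : R) (C : 'M[R]_d)
    (s s' : ehrenfest_state) : R :=
  let: (k, j) := s in let: (k', j') := s' in
  if k == 0%N :> nat then
    if k' == 1%N :> nat then C j j' * lambda * N%:R else 0
  else if j' != j then 0
  else if k'.+1 == k :> nat then mu * (N%:R + k%:R)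
  else if k' == k.+1 :> nat then lambda * (N%:R - k%:R)
  else 0.

Definition particles (s : ehrenfest_state) : nat := s.1.

End Ehrenfest.

Definition ehrenfest_g (R : realType) (rho : R) (N : nat) : R :=
  1 / hyp2F1 (- N%:R) 1 (1 + N%:R) (- rho).

(* Main.v *)
(* The particle count is a lumping of the chain: since the rows of C sum to 1,
   the generator sends a function of the count to a function of the count, by the
   formula of a birth-death generator with birth rates lambda (N - k) and death
   rates mu (N + k), k > 0. The weights w_k = rho^k 'C(2N, N + k) are in detailed
   balance with these rates. Hence, if x_k(t) is the law of the count, the
   chi-square distance sum_k (x_k - w_k / W)^2 / w_k to w / W, W = sum_k w_k, has
   for derivative minus twice the Dirichlet form of x / w, and a Poincare
   inequality on the path 0, ..., N makes it decay exponentially. Finally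
   W / 'C(2N, N) is the terminating series 2F1(-N, 1; 1 + N; -rho). *)

Require Import Defs.
From HB Require Import structures.
From mathcomp Require Import all_boot all_order all_algebra.
From mathcomp Require Import all_classical all_reals all_analysis.
From mathcomp Require Import ring lra.

Import Order.TTheory GRing.Theory Num.Theory.
Import numFieldNormedType.Exports.

Local Open Scope classical_set_scope.
Local Open Scope ring_scope.

(** * Kolmogorov's forward equation for a finite chain *)

Lemma cvgr_sum {R : numFieldType} {T : Type} {F : set_system T} {FF : Filter F}
    {I : Type} (r : seq I) (P : pred I) (f : I -> T -> R) (l : I -> R) :
  (forall i, f i x @[x --> F] --> l i) ->
  \sum_(i <- r | P i) f i x @[x --> F] --> \sum_(i <- r | P i) l i.
Proof. by move=> fl; apply: cvg_big => //; exact: add_continuous. Qed.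

Definition expect_from {R : realType} {S : finType} (p : R -> S -> S -> R)
    (phi : S -> R) (t : R) (s : S) : R := \sum_r p t s r * phi r.

Section forward_equation.
Context {R : realType} {S : finType} {q : S -> S -> R} {p : R -> S -> S -> R}.
Hypothesis tp : transition_function q p.
Implicit Types (phi : S -> R) (t h : R) (s : S).

Lemma expect_from0 phi s : expect_from p phi 0 s = phi s.
Proof.
rewrite /expect_from (bigD1 s)//= (trans_0 tp) eqxx mul1r big1 ?addr0// => r rs.
by rewrite (trans_0 tp) eq_sym (negbTE rs) mul0r.
Qed.

Lemma expect_fromD phi t h s : 0 <= t -> 0 <= h ->
  expect_from p phi (t + h) s = expect_from p (expect_from p phi h) t s.
Proof.
move=> t0 h0; rewrite /expect_from.
under eq_bigr do rewrite (trans_add tp)// mulr_suml.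
rewrite exchange_big/=; apply: eq_bigr => r _.
by rewrite mulr_sumr; apply: eq_bigr => r' _; rewrite mulrA.
Qed.

Lemma expect_from_increment phi t h s : 0 <= t -> 0 <= h ->
  expect_from p phi (t + h) s - expect_from p phi t s =
  \sum_r p t s r * (expect_from p phi h r - phi r).
Proof.
move=> t0 h0; rewrite expect_fromD// -sumrB.
by apply: eq_bigr => r _; rewrite mulrBr.
Qed.

Lemma trans_le1 t s s' : 0 <= t -> p t s s' <= 1.
Proof.
move=> t0; rewrite -(trans_sum1 tp s t0) (bigD1 s')//= lerDl.
by apply: sumr_ge0 => r _; exact: (trans_ge0 tp).
Qed.

Lemma expect_from_rate phi s :
  (expect_from p phi h s - phi s) / h @[h --> 0^'+] -->
  \sum_r generator q s r * phi r.
Proof.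
have -> : (fun h => (expect_from p phi h s - phi s) / h) =
    fun h => \sum_r (p h s r - (s == r)%:R) / h * phi r.
  apply/funext => h; rewrite -[X in _ - X]expect_from0 /expect_from -sumrB mulr_suml.
  by apply: eq_bigr => r _; rewrite (trans_0 tp) -mulrBl mulrAC.
apply: cvgr_sum => r; apply: cvgM; [exact: (trans_rate tp)|exact: cvg_cst].
Qed.

Lemma expect_from_cvg0 phi s :
  expect_from p phi h s - phi s @[h --> 0^'+] --> (0 : R).
Proof.
have : (expect_from p phi h s - phi s) / h * h @[h --> 0^'+] -->
    (\sum_r generator q s r * phi r) * 0.
  apply: cvgM; first exact: expect_from_rate.
  by apply: cvg_at_right_filter; exact: cvg_id.
rewrite mulr0; apply: cvg_trans; apply: near_eq_cvg.
near=> h; rewrite divfK//; apply: lt0r_neq0; near: h; exact: nbhs_right_gt.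
Unshelve. all: by end_near. Qed.


(** The increment from [t - h] to [t] averages the short-time increments
    [expect_from p phi h r - phi r] with weights [p (t - h) s r] in [0, 1]. There are finitely many
    of them and each tends to 0, uniformly in the weights. *)
Lemma expect_from_left_cvg phi t s : 0 < t ->
  expect_from p phi (t - h) s @[h --> 0^'+] --> expect_from p phi t s.
Proof.
move=> t0; rewrite -[X in _ --> X]subr0.
have -> : (fun h => expect_from p phi (t - h) s) = (fun h =>
  expect_from p phi t s - (expect_from p phi t s - expect_from p phi (t - h) s)).
  by apply/funext => h; rewrite subKr.
apply: cvgB; first exact: cvg_cst.
apply: norm_cvg0.
apply: (@squeeze_cvgr _ _ _ _ (cst 0) (fun h => \sum_r `|expect_from p phi h r - phi r|)).
- near=> h.
  have h0 : 0 < h by near: h; exact: nbhs_right_gt.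
  have ht : 0 <= t - h by rewrite subr_ge0 ltW//; near: h; exact: nbhs_right_lt.
  rewrite normr_ge0/= -[X in expect_from p phi X s - _](subrK h t) expect_from_increment ?(ltW h0)//.
  apply: le_trans (ler_norm_sum _ _ _) _; apply: ler_sum => r _.
  by rewrite normrM ler_piMl// ger0_norm ?trans_le1 ?(trans_ge0 tp).
- exact: cvg_cst.
- rewrite [X in _ --> X](_ : 0 = \sum_(r : S) 0); last by rewrite big1.
  by apply: cvgr_sum => r; apply/norm_cvg0P; exact: expect_from_cvg0.
Unshelve. all: by end_near. Qed.

(** The forward equation tested against [phi]. A transition function is only assumed to have right
    derivatives at time 0; Chapman-Kolmogorov carries these to both one-sided difference quotients
    at [t]. *)
Lemma is_derive_expect_from phi t s : 0 < t ->
  is_derive t 1 (expect_from p phi ^~ s)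
    (expect_from p (fun r => \sum_r' generator q r r' * phi r') t s).
Proof.
move=> t0.
(* As the expectation of an indicator, [p u s r] falls under the left continuity lemma. *)
have p_expect u r : p u s r = expect_from p (fun r' => (r' == r)%:R) u s.
  rewrite /expect_from (bigD1 r)//= eqxx mulr1 big1 ?addr0// => r' /negbTE ->.
  by rewrite mulr0.
suff H : h^-1 *: (expect_from p phi (h *: 1 + t) s - expect_from p phi t s)
    @[h --> 0^'] -->
    expect_from p (fun r => \sum_r' generator q r r' * phi r') t s.
  by apply: DeriveDef; [apply/cvg_ex; eexists; exact: H | exact: cvg_lim H].
apply: (@cvg_at_right_left_dnbhs _ R^o).
- have : \sum_r p t s r * ((expect_from p phi h r - phi r) / h) @[h --> 0^'+] -->
    expect_from p (fun r => \sum_r' generator q r r' * phi r') t s.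
    apply: cvgr_sum => r; apply: cvgM; [exact: cvg_cst|exact: expect_from_rate].
  apply: cvg_trans; apply: near_eq_cvg; near=> h.
  have h0 : 0 < h by near: h; exact: nbhs_right_gt.
  rewrite /= scaler1 [h + t]addrC expect_from_increment ?(ltW h0) ?(ltW t0)// scaler_sumr.
  by apply: eq_bigr => r _; rewrite mulrA mulrC.
(* On the left the increment starts from time [t - h], so the weights vary with [h] and converge by
   left continuity. *)
- apply/cvg_at_leftNP; rewrite oppr0.
  have : \sum_r expect_from p (fun r' => (r' == r)%:R) (t - h) s *
     ((expect_from p phi h r - phi r) / h) @[h --> 0^'+] -->
    expect_from p (fun r => \sum_r' generator q r r' * phi r') t s.
    rewrite [X in _ --> X]/expect_from.
    apply: cvgr_sum => r; rewrite p_expect.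
    by apply: cvgM; [exact: expect_from_left_cvg|exact: expect_from_rate].
  apply: cvg_trans; apply: near_eq_cvg; near=> h.
  have h0 : 0 < h by near: h; exact: nbhs_right_gt.
  have ht : 0 <= t - h by rewrite subr_ge0 ltW//; near: h; exact: nbhs_right_lt.
  rewrite /= scaler1 [- h + t]addrC invrN scaleNr -scalerN opprB.
  rewrite -[X in expect_from p phi X s - _](subrK h t) expect_from_increment ?(ltW h0)// scaler_sumr.
  by apply: eq_bigr => r _; rewrite -p_expect mulrA mulrC.
Unshelve. all: by end_near. Qed.

End forward_equation.

(** Gronwall's argument: [expR (c * t) * V t] has nonpositive derivative, hence stays below its
    value at time 1. Starting from 1 rather than 0 avoids any regularity at 0. *)
Lemma exponential_decay {R : realType} (V dV : R -> R) (c : R) : 0 < c ->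
  (forall t : R, 0 < t -> 0 <= V t) ->
  (forall t : R, 0 < t -> is_derive t 1 V (dV t)) ->
  (forall t : R, 0 < t -> dV t <= - c * V t) ->
  V t @[t --> +oo] --> 0.
Proof.
move=> c0 V0 derV dVle.
pose G := fun t => expR (c * t) * V t.
have derG (t : R) : 0 < t -> is_derive t 1 G (expR (c * t) * (c * V t + dV t)).
  move=> t0; have ? := derV t t0.
  apply: is_derive_eq; rewrite /GRing.scale/= mulr1; ring.
have Gle (t : R) : 1 <= t -> G t <= G 1.
  move=> t1; apply: (@ler0_derive1_nincry _ G 1) => // [x|x|].
  - rewrite in_itv/= andbT => x1.
    by have [] := derG x (lt_trans ltr01 x1).
  - rewrite in_itv/= andbT => x1; have x0 := lt_trans ltr01 x1.
    rewrite derive1E (@derive_val _ _ _ _ _ _ _ (derG x x0)).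
    rewrite mulr_ge0_le0 ?expR_ge0//.
    by have := dVle x x0; lra.
  - apply: derivable_within_continuous => x.
    rewrite in_itv/= andbT => x1.
    by have [] := derG x (lt_le_trans ltr01 x1).
apply: (@squeeze_cvgr _ _ _ _ (cst 0) (fun t => G 1 * expR (- (c * t)))).
- near=> t.
  have t1 : 1 <= t by near: t; exact: nbhs_pinfty_ge.
  rewrite V0 ?(lt_le_trans ltr01)//= expRN ler_pdivlMr ?expR_gt0// mulrC.
  exact: Gle.
- exact: cvg_cst.
- rewrite -[X in _ --> X](mulr0 (G 1)); apply: cvgM; first exact: cvg_cst.
  apply: (cvg_comp (fun t => c * t) (fun t => expR (- t))); last exact: cvgr_expR.
  by apply: gt0_cvgMry; [exact: c0|exact: cvg_id].
Unshelve. all: by end_near. Qed.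

(** * Birth-death dynamics: Dirichlet form, spectral gap, convergence *)

Definition birth_death {R : pzRingType} (b d g : nat -> R) (k : nat) : R :=
  b k * (g k.+1 - g k) + d k * (g k.-1 - g k).

Section birth_death.
Context {R : realType} {N : nat}.
Variables w b d : nat -> R.
Hypothesis w_gt0 : forall k, (k <= N)%N -> 0 < w k.
Hypothesis b_gt0 : forall k, (k < N)%N -> 0 < b k.
Hypothesis bN : b N = 0.
Hypothesis d0 : d 0%N = 0.
Hypothesis balance : forall k, (k < N)%N -> b k * w k = d k.+1 * w k.+1.

(** Summation by parts. The birth term at [k] and the death term at [k.+1] live on the same edge
    and, by detailed balance, have the same conductance [b k * w k], so they combine into a square.
    The two boundary terms vanish by [bN] and [d0]. *)
Lemma dirichlet_form (f : nat -> R) :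
  \sum_(k < N.+1) w k * f k * birth_death b d f k =
  - \sum_(k < N) b k * w k * (f k.+1 - f k) ^+ 2.
Proof.
rewrite /birth_death; under eq_bigr do rewrite mulrDr.
rewrite big_split/= big_ord_recr/= bN mul0r mulr0 addr0.
rewrite [X in _ + X]big_ord_recl/= d0 mul0r mulr0 add0r.
rewrite -big_split -sumrN; apply: eq_bigr => k _ /=.
rewrite /bump/= add1n.
transitivity (b k * w k * f k * (f k.+1 - f k) +
  d k.+1 * w k.+1 * f k.+1 * (f k - f k.+1)); first by ring.
by rewrite -balance//; ring.
Qed.

(** Iterating (y + z)^2 <= 2 (y^2 + z^2) yields the factor [2 ^+ k]. Cauchy-Schwarz would give [k],
    but the gap only has to be positive. *)
Lemma sqr_telescope_le (f : nat -> R) k :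
  (f k - f 0%N) ^+ 2 <= 2 ^+ k * \sum_(i < k) (f i.+1 - f i) ^+ 2.
Proof.
elim: k => [|k IH]; first by rewrite subrr expr0n big_ord0 mulr0.
rewrite big_ord_recr/= [2 ^+ _]exprS.
set D := \sum_(i < k) _ in IH *; set p := 2 ^+ k in IH *.
have p_ge1 : 1 <= p by rewrite exprn_ege1// ler1n.
have step_sq : (f k.+1 - f k) ^+ 2 <= p * (f k.+1 - f k) ^+ 2.
  by rewrite ler_peMl// sqr_ge0.
have -> : f k.+1 - f 0%N = (f k.+1 - f k) + (f k - f 0%N) by ring.
move: (f k.+1 - f k) (f k - f 0%N) IH step_sq => y z IH step_sq.
rewrite -mulrA mulrDr; apply: (@le_trans _ _ (2 * (z ^+ 2 + y ^+ 2))).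
  by have := sqr_ge0 (y - z); rewrite sqrrB sqrrD; lra.
by rewrite ler_pM2l// lerD.
Qed.

(** Poincare inequality on a path. The variance is at most the mean square deviation from [f 0%N],
    each deviation telescopes along edges, and each squared edge increment is at most
    [(b k * w k)^-1] times the Dirichlet form. *)
Lemma spectral_gap : exists2 c : R, 0 < c &
  forall (f : nat -> R) (m : R),
    \sum_(k < N.+1) w k * (f k - m) = 0 ->
    c * \sum_(k < N.+1) w k * (f k - m) ^+ 2 <=
    \sum_(k < N) b k * w k * (f k.+1 - f k) ^+ 2.
Proof.
pose W := \sum_(k < N.+1) w k.
pose A := \sum_(k < N) (b k * w k)^-1.
have a_gt0 (k : 'I_N) : 0 < b k * w k.
  by rewrite mulr_gt0// ?b_gt0// w_gt0// ltnW.
have W_ge0 : 0 <= W.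
  by apply: sumr_ge0 => k _; rewrite ltW// w_gt0// -ltnS.
have A_ge0 : 0 <= A by apply: sumr_ge0 => k _; rewrite invr_ge0 ltW.
pose K := W * (2 ^+ N * A).
have K_ge0 : 0 <= K by rewrite !mulr_ge0// exprn_ge0.
(* [K] bounds the variance by the Dirichlet form, but it is 0 when [N] is 0; adding 1 keeps the
   constant invertible. *)
exists (1 + K)^-1 => [|f m fm]; first by rewrite invr_gt0 ltr_pwDl.
pose D := \sum_(k < N) b k * w k * (f k.+1 - f k) ^+ 2.
have D_ge0 : 0 <= D.
  by apply: sumr_ge0 => k _; rewrite mulr_ge0 ?sqr_ge0// ltW.
have sumsq_le : \sum_(k < N) (f k.+1 - f k) ^+ 2 <= A * D.
  rewrite /A mulr_suml; apply: ler_sum => k _.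
  rewrite ler_pdivlMl// /D (bigD1 k)//= lerDl.
  by apply: sumr_ge0 => i _; rewrite mulr_ge0 ?sqr_ge0// ltW.
have dev_le (k : 'I_N.+1) : (f k - f 0%N) ^+ 2 <= 2 ^+ N * A * D.
  apply: (le_trans (sqr_telescope_le f k)).
  rewrite -mulrA ler_pM ?exprn_ge0 ?sumr_ge0// => [i _||].
  - exact: sqr_ge0.
  - by rewrite ler_weXn2l ?ler1n// -ltnS.
  apply: le_trans sumsq_le.
  have kN : (k <= N)%N by rewrite -ltnS.
  rewrite -!(big_mkord xpredT (fun i => (f i.+1 - f i) ^+ 2)).
  rewrite (big_cat_nat (leq0n k) kN)/= lerDl.
  by apply: sumr_ge0 => i _; exact: sqr_ge0.
(* The mean m minimizes the quadratic deviation from a constant. *)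
have var_le : \sum_(k < N.+1) w k * (f k - m) ^+ 2 <=
    \sum_(k < N.+1) w k * (f k - f 0%N) ^+ 2.
  have -> : \sum_(k < N.+1) w k * (f k - f 0%N) ^+ 2 =
    \sum_(k < N.+1) w k * (f k - m) ^+ 2 + W * (m - f 0%N) ^+ 2 +
    2 * (m - f 0%N) * \sum_(k < N.+1) w k * (f k - m).
    rewrite /W mulr_suml mulr_sumr -!big_split/=; apply: eq_bigr => k _; ring.
  by rewrite fm mulr0 addr0 lerDl mulr_ge0 ?sqr_ge0.
rewrite ler_pdivrMl; last by rewrite ltr_pwDl.
apply: (le_trans var_le); apply: (@le_trans _ _ (K * D)).
  rewrite /K /W -mulrA mulr_suml; apply: ler_sum => k _.
  by rewrite ler_wpM2l ?dev_le// ltW// w_gt0// -ltnS.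
by rewrite ler_wpM2r// lerDr.
Qed.

Variable x : nat -> R -> R.
Hypothesis forward : forall (g : nat -> R) (t : R), 0 < t ->
  is_derive t 1 (fun u => \sum_(k < N.+1) x k u * g k)
    (\sum_(k < N.+1) x k t * birth_death b d g k).
Hypothesis x_sum1 : forall t : R, 0 < t -> \sum_(k < N.+1) x k t = 1.

Lemma birth_death_cvg k : (k <= N)%N ->
  x k t @[t --> +oo] --> w k / \sum_(i < N.+1) w i.
Proof.
move=> kN; pose W := \sum_(i < N.+1) w i; rewrite -/W.
have W_gt0 : 0 < W.
  rewrite /W big_ord_recl ltr_pwDl ?w_gt0// sumr_ge0// => i _.
  by rewrite ltW// w_gt0// ltn_ord.
have wi_gt0 (i : 'I_N.+1) : 0 < w i by rewrite w_gt0// -ltnS.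
(* The forward equation tested on the indicator of [i] gives the derivative of [x i]. *)
pose dx i t := \sum_(j < N.+1) x j t * birth_death b d (fun l => (l == i)%:R) j.
have derx (i : 'I_N.+1) (t : R) : 0 < t -> is_derive t 1 (x i) (dx i t).
  move=> t0; have := forward (fun l => (l == i)%:R) _ t0.
  congr (is_derive _ _ _ _); apply/funext => u.
  rewrite (bigD1 i)//= eqxx mulr1 big1 ?addr0// => j ji.
  by rewrite (_ : (j == i :> nat) = false) ?mulr0//; exact/negbTE.
pose V t := \sum_(i < N.+1) (x i t - w i / W) ^+ 2 / w i.
pose f t l := x l t / w l.
(* [g t] is the gradient of [V] with respect to the law, taken at [x] at time [t]. *)
pose g t l := 2 * (f t l - W^-1).
have derV (t : R) : 0 < t ->
    is_derive t 1 V (\sum_(i < N.+1) x i t * birth_death b d (g t) i).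
  move=> t0.
  have -> : V = \sum_(i < N.+1) (fun t => (x i t - w i / W) ^+ 2 / w i).
    by apply/funext => u; rewrite fct_sumE.
  have dsum : is_derive t 1 (fun u => \sum_(i < N.+1) x i u * g t i)
      (\sum_(i < N.+1) dx i t * g t i).
    have -> : (fun u => \sum_(i < N.+1) x i u * g t i) =
        \sum_(i < N.+1) (fun u => x i u * g t i).
      by apply/funext => u; rewrite fct_sumE.
    apply: is_derive_sum => i; have ? := derx i _ t0.
    by apply: is_derive_eq; rewrite /GRing.scale/=; ring.
  (* With [g t] frozen at time [t], the forward equation and termwise differentiation compute the
     same derivative; the latter form is what the chain rule gives for [V]. *)
  rewrite -(@derive_val _ _ _ _ _ _ _ (forward (g t) _ t0)) (@derive_val _ _ _ _ _ _ _ dsum).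
  apply: is_derive_sum => i; have ? := derx i _ t0.
  apply: is_derive_eq; rewrite /GRing.scale/= /g /f.
  by field; rewrite !gt_eqF.
have [c c0 gap] := spectral_gap.
have V_cvg0 : V t @[t --> +oo] --> 0.
  apply: (@exponential_decay _ V _ (2 * c) _ _ derV).
  - by rewrite mulr_gt0.
  - move=> t t0; apply: sumr_ge0 => i _.
    by rewrite mulr_ge0 ?sqr_ge0// invr_ge0 ltW.
  move=> t t0.
  have VE : V t = \sum_(i < N.+1) w i * (f t i - W^-1) ^+ 2.
    by apply: eq_bigr => i _; rewrite /f; field; rewrite !gt_eqF.
  (* The generator sees only differences, so the constant [W^-1] in [g] drops out. *)
  have -> : \sum_(i < N.+1) x i t * birth_death b d (g t) i =
      2 * \sum_(i < N.+1) w i * f t i * birth_death b d (f t) i.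
    rewrite mulr_sumr; apply: eq_bigr => i _.
    have -> : x i t = w i * f t i by rewrite /f mulrC divfK ?gt_eqF.
    by rewrite /birth_death /g; ring.
  rewrite dirichlet_form VE !mulNr mulrN lerN2 -mulrA ler_pM2l//; apply: gap.
  (* The centring required by the gap: [x] and [w / W] both have total mass 1. *)
  under eq_bigr do rewrite mulrBr; rewrite sumrB -mulr_suml divff ?gt_eqF//.
  rewrite -[in X in _ - X](x_sum1 _ t0) -sumrB big1// => i _.
  by rewrite /f; field; rewrite gt_eqF.
apply/subr_cvg0; apply: norm_cvg0.
(* A single term of [V] already bounds the squared deviation of [x k] by [w k * V t]. *)
apply: (@squeeze_cvgr R +oo%R _ R (cst 0) (fun t : R => Num.sqrt (w k * V t))).
- near=> t; have t0 : 0 < t by near: t; exact: nbhs_pinfty_gt.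
  rewrite normr_ge0/= -sqrtr_sqr ler_wsqrtr// -ler_pdivrMl ?w_gt0//.
  rewrite mulrC /V (bigD1 (Ordinal (kN : (k < N.+1)%N)))//= lerDl.
  by apply: sumr_ge0 => i _; rewrite mulr_ge0 ?sqr_ge0// invr_ge0 ltW.
- exact: cvg_cst.
- rewrite -[X in _ --> X](sqrtr0 R) -[X in Num.sqrt X](mulr0 (w k)).
  apply: (continuous_cvg _ (@sqrt_continuous R _)).
  by apply: cvgM; first exact: cvg_cst.
Unshelve. all: by end_near. Qed.

End birth_death.

(** * The Ehrenfest weights and the terminating hypergeometric series *)

Section ehrenfest.
Context {R : realType}.
Implicit Types (lambda mu rho : R) (N k : nat).

Definition ehrenfest_weight rho N k : R := rho ^+ k * 'C(2 * N, N + k)%:R.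

Lemma pochhammerS (a : R) k : pochhammer a k.+1 = pochhammer a k * (a + k%:R).
Proof. by rewrite /pochhammer big_ord_recr. Qed.

Lemma pochhammer1 k : pochhammer (1 : R) k = k`!%:R.
Proof.
elim: k => [|k IH]; first by rewrite /pochhammer big_ord0.
by rewrite pochhammerS IH factS natrM mulrC -natr1 addrC.
Qed.

Lemma pochhammerN_eq0 N k : (N < k)%N -> pochhammer (- N%:R : R) k = 0.
Proof.
move=> Nk; rewrite /pochhammer (bigD1 (Ordinal Nk))//=.
by rewrite addNr mul0r.
Qed.

(** The ratio of consecutive binomials in row 2N, at N + k. It yields both the coefficients of the
    series and detailed balance. *)
Lemma bin_shiftS N k : (k < N)%N ->
  'C(2 * N, N + k)%:R * (N%:R - k%:R) =
  'C(2 * N, N + k.+1)%:R * (N%:R + k.+1%:R) :> R.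
Proof.
move=> kN; rewrite -natrB 1?ltnW// -natrD -!natrM; congr _%:R.
rewrite addnS [LHS]mulnC [RHS]mulnC mul_bin_left; congr (_ * _)%N.
by rewrite mul2n -addnn subnDl.
Qed.

(** A cross-multiplied formula for the ratio of 'C(2N, N + k) to 'C(2N, N). By induction: the next
    factor on the left is N - k once the sign is absorbed, and [bin_shiftS] turns it into the next
    factor on the right. *)
Lemma pochhammer_ratio N k : (k <= N)%N ->
  pochhammer (- N%:R) k * (-1) ^+ k * 'C(2 * N, N)%:R =
  'C(2 * N, N + k)%:R * pochhammer (1 + N%:R : R) k.
Proof.
elim: k => [_|k IH kN].
  by rewrite /pochhammer !big_ord0 addn0 !mulr1 mul1r.
rewrite !pochhammerS exprS.
transitivity (pochhammer (- N%:R) k * (-1) ^+ k * 'C(2 * N, N)%:R *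
  (N%:R - k%:R) : R); first by ring.
rewrite IH 1?ltnW// mulrAC bin_shiftS// -mulrA -natr1; congr (_ * _).
by rewrite mulrC; congr (_ * _); ring.
Qed.

Lemma pochhammer1D_neq0 N k : pochhammer (1 + N%:R : R) k != 0.
Proof. by apply/prodf_neq0 => i _; rewrite nat1r -natrD pnatr_eq0. Qed.

Lemma hyp2F1_ehrenfest rho N :
  hyp2F1 (- N%:R) 1 (1 + N%:R) (- rho) =
  (\sum_(k < N.+1) ehrenfest_weight rho N k) / 'C(2 * N, N)%:R.
Proof.
rewrite /hyp2F1.
have bin_neq0 : 'C(2 * N, N)%:R != 0 :> R.
  by rewrite pnatr_eq0 -lt0n bin_gt0 leq_pmull.
(* [(- N%:R)] has zero Pochhammer symbol beyond [N], so the partial sums are constant from index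
   [N.+1] on. *)
apply: lim_near_cst => //; exists N.+1 => // n /= Nn.
rewrite /series/= (big_cat_nat (leq0n N.+1) Nn)/= [X in _ + X]big1_seq ?addr0.
  rewrite big_mkord mulr_suml; apply: eq_bigr => k _.
  have kN : (k <= N)%N by rewrite -ltnS.
  have := pochhammer_ratio N k kN; have := pochhammer1D_neq0 N k.
  have : k`!%:R != 0 :> R by rewrite pnatr_eq0 -lt0n fact_gt0.
  rewrite /ehrenfest_weight pochhammer1 [(- rho) ^+ _]exprNn.
  move: (pochhammer _ k) (pochhammer _ k) (_ ^+ k) (_ ^+ k) k`!%:R bin_neq0.
  move: 'C(_, _)%:R 'C(_, _)%:R => u v y z s r r' v_neq0 r'_neq0 z_neq0 E.
  have -> : u = y * r * v / z by rewrite E mulfK.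
  by field; rewrite v_neq0 r'_neq0 z_neq0.
move=> k /andP[_]; rewrite mem_index_iota => /andP[Nk _].
by rewrite pochhammerN_eq0// !mul0r.
Qed.

End ehrenfest.

(** * Lumping the chain to the particle count *)

Lemma generator_sum {R : realType} {S : finType} (q : S -> S -> R)
    (phi : S -> R) (s : S) :
  \sum_r generator q s r * phi r = \sum_r q s r * (phi r - phi s).
Proof.
rewrite (bigD1 s)//= [RHS](bigD1 s)//= subrr mulr0 add0r.
rewrite /generator eqxx mulNr mulr_suml addrC -sumrB.
by apply: eq_bigr => r rs; rewrite eq_sym (negbTE rs) mulrBr.
Qed.

Section ehrenfest_chain.
Context {R : realType} {N d : nat}.
Variables (lambda mu : R) (C : 'M[R]_d).
Hypothesis lambda_gt0 : 0 < lambda.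
Hypothesis mu_gt0 : 0 < mu.
Hypothesis C_stoch : stochastic_mx C.
Implicit Types (s : ehrenfest_state N d) (k : nat).

Definition birth_rate k : R := lambda * (N%:R - k%:R).
(** The indicator is needed at [k = 0], where the bare formula would give [mu * N%:R] although no
    particle can die. *)
Definition death_rate k : R := (0 < k)%:R * (mu * (N%:R + k%:R)).

Lemma sum_ord_eq (F : nat -> R) n m :
  \sum_(i < n) (if i == m :> nat then F i else 0) = if (m < n)%N then F m else 0.
Proof. by rewrite -big_mkcond big_ord1_eq. Qed.

(** From an empty state every move leads to count 1, with total rate lambda N because the row of [C]
    sums to 1. From a nonempty state the type is kept, so a single [j'] contributes. Either way the
    type disappears. *)
Lemma ehrenfest_rate_sum (g : nat -> R) s :
  \sum_s' ehrenfest_rate lambda mu C s s' * g (particles s') =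
  birth_rate (particles s) * g (particles s).+1 +
  death_rate (particles s) * g (particles s).-1.
Proof.
case: s => k j; transitivity (\sum_(k' < N.+1) \sum_(j' < d)
    ehrenfest_rate lambda mu C (k, j) (k', j') * g k').
  by rewrite pair_big/=; apply: eq_bigr => -[].
rewrite /=.
have [k0|k0] := eqVneq (k : nat) 0%N.
  rewrite /particles/= k0 /birth_rate /death_rate ltnn mul0r mul0r addr0 subr0.
  transitivity (\sum_(k' < N.+1)
    if k' == 1%N :> nat then lambda * N%:R * g k' else 0).
    apply: eq_bigr => k' _; case: eqP => [->|_].
      under eq_bigr do rewrite -!mulrA.
      by rewrite -mulr_suml (C_stoch.2 j) mul1r mulrA.
    by rewrite big1// => j' _; rewrite mul0r.
  rewrite (sum_ord_eq (fun k' => lambda * N%:R * g k')) ltnS.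
  (* If [N] is 0 there is no state with one particle, and the rate lambda N is 0 as well. *)
  by case: ltnP => //; rewrite leqn0 => /eqP ->; rewrite mulr0 mul0r.
transitivity (\sum_(k' < N.+1)
    ((if k' == k.+1 :> nat then birth_rate k * g k' else 0) +
     (if k' == k.-1 :> nat then death_rate k * g k' else 0))).
  apply: eq_bigr => k' _.
  rewrite (bigD1 j)//= big1 => [|j' /negbTE ->]; last by rewrite mul0r.
  rewrite eqxx/= addr0 -{1}(prednK (_ : (0 < k)%N)) ?lt0n// eqSS.
  rewrite /birth_rate /death_rate lt0n k0 mul1r.
  case: (eqVneq (k' : nat) k.-1) => [k'E|_]; last first.
    by case: ifP; rewrite addr0 ?mul0r.
  by rewrite k'E ltn_eqF ?add0r// ltnS leq_pred.
rewrite big_split/= (sum_ord_eq (fun k' => birth_rate k * g k')).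
rewrite (sum_ord_eq (fun k' => death_rate k * g k')).
rewrite (_ : (k.-1 < N.+1)%N); last by rewrite (leq_ltn_trans (leq_pred k)).
(* At [k = N] the count [N.+1] is outside the state space, consistently with [birth_rate N = 0]. *)
congr (_ + _); rewrite ltnS /particles/=; case: ltnP => // Nk.
have -> : (k : nat) = N by apply/eqP; rewrite eqn_leq Nk -ltnS ltn_ord.
by rewrite /birth_rate subrr mulr0 mul0r.
Qed.

Lemma ehrenfest_generator (g : nat -> R) s :
  \sum_s' generator (ehrenfest_rate lambda mu C) s s' * g (particles s') =
  birth_death birth_rate death_rate g (particles s).
Proof.
rewrite (generator_sum _ (fun s => g (particles s))).
by rewrite (ehrenfest_rate_sum (fun n => g n - g (particles s))).
Qed.

Definition count_prob (p : R -> ehrenfest_state N d -> ehrenfest_state N d -> R)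
  s k (t : R) : R := \sum_(s' | particles s' == k) p t s s'.

Lemma sum_count_prob p s (g : nat -> R) t :
  \sum_(k < N.+1) count_prob p s k t * g k =
  expect_from p (fun s' => g (particles s')) t s.
Proof.
rewrite /expect_from (partition_big (fun s' => s'.1) xpredT)//=.
apply: eq_bigr => k _; rewrite /count_prob mulr_suml.
by apply: eq_big => // s' /eqP <-.
Qed.

Lemma ehrenfest_weight_balance k : (k < N)%N ->
  birth_rate k * ehrenfest_weight (lambda / mu) N k =
  death_rate k.+1 * ehrenfest_weight (lambda / mu) N k.+1.
Proof.
move=> kN; rewrite /birth_rate /death_rate /ehrenfest_weight ltn0Sn mul1r.
transitivity (lambda * (lambda / mu) ^+ k * ('C(2 * N, N + k)%:R * (N%:R - k%:R))).
  by ring.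
rewrite bin_shiftS// exprS -{1}(divfK (lt0r_neq0 mu_gt0) lambda).
ring.
Qed.

Lemma ehrenfest_weight_gt0 k : (k <= N)%N -> 0 < ehrenfest_weight (lambda / mu) N k.
Proof.
move=> kN; rewrite mulr_gt0 ?exprn_gt0 ?divr_gt0// ltr0n bin_gt0.
by rewrite mul2n -addnn leq_add2l.
Qed.

Lemma count_prob_cvg p s k : transition_function (ehrenfest_rate lambda mu C) p ->
  (k <= N)%N ->
  count_prob p s k t @[t --> +oo] -->
  ehrenfest_weight (lambda / mu) N k /
  \sum_(i < N.+1) ehrenfest_weight (lambda / mu) N i.
Proof.
move=> tp kN; apply: (@birth_death_cvg R N _ birth_rate death_rate) => //.
- exact: ehrenfest_weight_gt0.
- by move=> i iN; rewrite mulr_gt0// subr_gt0 ltr_nat.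
- by rewrite /birth_rate subrr mulr0.
- by rewrite /death_rate ltnn mul0r.
- exact: ehrenfest_weight_balance.
- move=> g t t0.
  rewrite (sum_count_prob p s (birth_death birth_rate death_rate g)).
  under eq_fun do rewrite sum_count_prob.
  (* Lumpability closes the forward equation on functions of the count. *)
  rewrite (_ : (fun s' => birth_death _ _ _ (particles s')) = fun s' =>
    \sum_r generator (ehrenfest_rate lambda mu C) s' r * g (particles r)).
    exact: (is_derive_expect_from tp).
  by apply/funext => s'; rewrite ehrenfest_generator.
- move=> t t0; rewrite -(trans_sum1 tp s (ltW t0)).
  transitivity (\sum_(i < N.+1) count_prob p s i t * 1).
    by apply: eq_bigr => i _; rewrite mulr1.
  rewrite (sum_count_prob p s (fun=> 1)) /expect_from.
  by apply: eq_bigr => i _; rewrite mulr1.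
Qed.

End ehrenfest_chain.

(** * From the random process to its transition function *)

(** The Markov property at time 0 with empty past, from the initial state [s0], gives the
    probability of each state at time [t]; the event for [A] is a finite disjoint union of these. *)
Lemma markov_chain_law {R : realType} {S : finType} {disp : measure_display}
    {T : measurableType disp} {P : probability T R} {X : R -> T -> S}
    {p : R -> S -> S -> R} (s0 : S) (t : R) (A : pred S) :
  markov_chain P X p -> P [set w | X 0 w = s0] = 1%E -> 0 <= t ->
  P [set w | A (X t w)] = (\sum_(s | A s) p t s0 s)%:E.
Proof.
move=> mc X0 t0.
have mX0 : measurable [set w | X 0 w = s0] by exact: (chain_measurable mc).
have law1 s : P [set w | X t w = s] = (p t s0 s)%:E.
  have /= := markov_prop mc (past := [::]) (t := 0) (h := t) s0 s.
  move=> /(_ (fun _ H => False_ind _ (notF H)) (lexx _) t0).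
  rewrite (_ : [set w | _] = setT); last by apply/seteqP; split.
  rewrite !setTI X0 mul1e add0r => <-.
  have mXt : measurable [set w | X t w = s] by exact: (chain_measurable mc).
  (* The chain starts at [s0] only almost surely; the part of the event where it does not is
     null. *)
  rewrite [LHS](measureDI _ mXt mX0) setIC [X in (X + _)%E](_ : _ = 0%E) ?add0e//.
  apply: (@subset_measure0 _ _ _ P _ (~` [set w | X 0 w = s0])).
  - exact: measurableD.
  - exact: measurableC.
  - by move=> w [].
  - by have := probability_setC P mX0; rewrite X0 subee.
rewrite (_ : [set w | A (X t w)] =
    \bigcup_(s in [set` enum A]) [set w | X t w = s]).
  rewrite measure_fin_bigcup//.
  - rewrite -fsbig_seq ?enum_uniq// big_enum/= -sumEFin.
    by apply: eq_bigr.
  - by move=> s s' _ _ [w [/= <- <-]].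
  - move=> s _; exact: (chain_measurable mc).
apply/seteqP; split=> w /=.
  by move=> Aw; exists (X t w) => //=; rewrite mem_enum.
by move=> [s /=]; rewrite mem_enum => As ->.
Qed.

Theorem proposition4p2 (R : realType) (N d : nat) (lambda mu : R)
  (C : 'M[R]_d) (l0 : 'I_d)
  (disp : measure_display) (T : measurableType disp) (P : probability T R)
  (X : R -> T -> ehrenfest_state N d)
  (lambda_gt0 : 0 < lambda) (mu_gt0 : 0 < mu) (C_stoch : stochastic_mx C)
  (X_ctmc : ctmc P X (ehrenfest_rate lambda mu C))
  (X_init : P [set w | X 0 w = (ord0, l0)] = 1%E)
  (k : nat) (k_le_N : (k <= N)%N) :
  let rho := lambda / mu in
  P [set w | particles (X t w) = k] @[t --> +oo%R] -->
    (ehrenfest_g rho N / ('C(2 * N, N))%:R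
       * rho ^+ k * ('C(2 * N, N + k))%:R)%:E.
Proof.
move=> rho; case: X_ctmc => p tp mc.
(* The series evaluates to the total weight over 'C(2N, N), so [ehrenfest_g] and the binomial
   combine into the normalization. *)
have -> : ehrenfest_g rho N / ('C(2 * N, N))%:R * rho ^+ k * ('C(2 * N, N + k))%:R
    = ehrenfest_weight rho N k / \sum_(i < N.+1) ehrenfest_weight rho N i.
  have bin_neq0 : 'C(2 * N, N)%:R != 0 :> R.
    by rewrite pnatr_eq0 -lt0n bin_gt0 leq_pmull.
  rewrite /ehrenfest_g hyp2F1_ehrenfest /ehrenfest_weight div1r invf_div.
  by rewrite -mulrA [_ / _ / _]mulrAC divff// div1r mulrC.
have := count_prob_cvg _ _ _ lambda_gt0 mu_gt0 C_stoch p (ord0, l0) k tp k_le_N.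
move=> count_cvg.
have : (count_prob p (ord0, l0) k t)%:E @[t --> +oo] -->
    (ehrenfest_weight rho N k / \sum_(i < N.+1) ehrenfest_weight rho N i)%:E.
  by apply: cvg_EFin => //; exact: nearW.
(* The law of the chain is given by [p] at nonnegative times, which is enough for the limit at
   infinity. *)
apply: cvg_trans; apply: near_eq_cvg; near=> t.
rewrite -(markov_chain_law _ _ (fun s => particles s == k) mc X_init).
  by congr (P _); apply/seteqP; split=> w /= /eqP.
by near: t; exact: nbhs_pinfty_ge.
Unshelve. all: by end_near. Qed.
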